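(* For every odd integer $a>1$, the sequence $(x_n^{(a)})_{n\ge1}$ essentially coincides with $(x_n^{(3)})_{n\ge1}$, i.e. there is $n_0$ such that $x_n^{(a)}=x_n^{(3)}$ for all $n\geq n_0$.
   Context: For a positive integer $m$, let $\nu_2(m)$ be the exponent of the highest power of $2$ dividing $m$. For an odd integer $a>1$ (so $\nu_2(a)=\nu_2(1)=0$), define $x_1^{(a)}=a$ and, for $n\ge2$, $x_n^{(a)}$ is the smallest integer $y>x_{n-1}^{(a)}$ with $\nu_2(y)=\nu_2(n)$. (For example $x^{(3)}$ begins $3,6,7,12,13,14,15,24,\dots$.) *)

(* Defs.v *)
From mathcomp Require Import all_boot.

Set Implicit Arguments.
Unset Strict Implicit.
Unset Printing Implicit Defensive.

Definition nu2 (m : nat) : nat := logn 2 m.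

Lemma next_nu2_exists (m n : nat) : exists y, (m < y) && (nu2 y == nu2 n).
Proof.
exists (2 ^ nu2 n * m.*2.+1); rewrite /nu2; apply/andP; split.
  apply: (@leq_trans m.*2.+1); first by rewrite ltnS -addnn leq_addr.
  by rewrite leq_pmull // expn_gt0.
rewrite lognM ?expn_gt0 // pfactorK // [logn 2 m.*2.+1]lognE.
by rewrite dvdn2 /= odd_double /= addn0.
Qed.

(* The smallest y > m with nu2 y = nu2 n; such a y is positive, so the
   convention logn 2 0 = 0 plays no role when n > 0. *)
Definition next_nu2 (m n : nat) : nat := ex_minn (next_nu2_exists m n).

(* The sequence is indexed from 1; the value 0 at index 0 is a dummy. *)
Fixpoint xseq (a n : nat) : nat :=
  match n with
  | 0 => 0
  | k.+1 => if k == 0 then a else next_nu2 (xseq a k) k.+1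
  end.

(* Main.v *)
Require Import Defs.
From mathcomp Require Import all_boot.
From mathcomp Require Import zify.

(** If x_{2^k} = q 2^k with q odd, then nu2 (2^k + i) = nu2 (q 2^k + i) for
    0 < i < 2^k, so the sequence runs through consecutive integers up to
    x_{2^(k+1) - 1} = (q + 1) 2^k - 1.  Hence x_{2^(k+1)} = q' 2^(k+1), where q'
    is the least odd integer >= (q + 1) / 2.  The map q |-> q' fixes 3 and
    decreases every odd q > 3 while keeping it above 1, so starting from q = a
    it reaches 3, that is, x_{2^k} = 3 * 2^k for some k; from that index on the
    sequence is the one with a = 3. *)

Lemma next_nu2_min (m n y : nat) :
  m < y -> nu2 y = nu2 n -> (forall z, m < z -> nu2 z = nu2 n -> y <= z) ->
  next_nu2 m n = y.
Proof.
move=> lt_my nu_y min_y; rewrite /next_nu2; case: ex_minnP => z.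
case/andP=> lt_mz /eqP nu_z min_z; apply/eqP; rewrite eqn_leq.
by rewrite min_y // min_z // lt_my nu_y eqxx.
Qed.

Lemma next_nu2_succ (m n : nat) : nu2 m.+1 = nu2 n -> next_nu2 m n = m.+1.
Proof. by move=> nu_m; apply: next_nu2_min. Qed.

Lemma nu2_odd_mul (q k : nat) : odd q -> nu2 (q * 2 ^ k) = k.
Proof.
move=> odd_q; have q_gt0 := odd_gt0 odd_q.
rewrite /nu2 lognM ?expn_gt0 // pfactorK // lognE dvdn2 odd_q !andbF.
exact: add0n.
Qed.

Lemma nu2_exp (k : nat) : nu2 (2 ^ k) = k.
Proof. by rewrite -[2 ^ k]mul1n nu2_odd_mul. Qed.

Lemma nu2_eq_oddmul (y k : nat) :
  0 < y -> nu2 y = k -> exists2 r, odd r & y = r * 2 ^ k.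
Proof.
move=> y_gt0 <-; have [//|r co_r def_y] := @pfactor_coprime 2 y _ y_gt0.
by exists r; rewrite // -coprime2n.
Qed.

(** For [j <= k], [2 ^ j] divides [q * 2 ^ k], hence divides the sum iff it divides [i]; and
    [i < 2 ^ k] forces [nu2 i < k]. *)
Lemma nu2_add_small (q k i : nat) :
  0 < i -> i < 2 ^ k -> nu2 (q * 2 ^ k + i) = nu2 i.
Proof.
move=> i_gt0 lt_i; have sum_gt0 : 0 < q * 2 ^ k + i by rewrite addn_gt0 i_gt0 orbT.
have le_dvd j : j <= k -> (j <= nu2 (q * 2 ^ k + i)) = (j <= nu2 i).
  move=> le_jk; rewrite -!pfactor_dvdn // dvdn_addr //.
  by rewrite dvdn_mull // dvdn_exp2l.
have lt_nuk : nu2 i < k.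
  rewrite -(ltn_exp2l _ _ (isT : 1 < 2)); apply: leq_ltn_trans lt_i.
  by rewrite dvdn_leq // pfactor_dvdnn.
apply/eqP; rewrite eqn_leq [nu2 i <= _]le_dvd ?leqnn ?(ltnW lt_nuk) // andbT.
(* Here [j] is [(nu2 i).+1], still at most [k]. *)
by rewrite leqNgt le_dvd // ltnn.
Qed.

(** The candidates are the odd multiples of [2 ^ k]; starting from the predecessor lets [m * 2 ^ k]
    itself be chosen when [m] is odd. *)
Lemma next_nu2_pred_mul (m k n : nat) : 0 < m -> nu2 n = k ->
  next_nu2 (m * 2 ^ k).-1 n = (m + ~~ odd m) * 2 ^ k.
Proof.
move=> m_gt0 nu_n; have pk_gt0 : 0 < 2 ^ k by rewrite expn_gt0.
have mk_gt0 : 0 < m * 2 ^ k by rewrite muln_gt0 m_gt0.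
apply: next_nu2_min => [||z].
- by rewrite prednK // leq_pmul2r // leq_addr.
- by rewrite nu2_odd_mul // oddD; case: odd.
rewrite prednK // nu_n => le_mz nu_z.
have [r odd_r def_z] := @nu2_eq_oddmul z k (leq_trans mk_gt0 le_mz) nu_z.
move: le_mz; rewrite {z nu_z}def_z !leq_pmul2r //.
have [//|even_m le_mr] := boolP (odd m); first by rewrite addn0.
rewrite addn1 ltn_neqAle le_mr andbT.
by apply: contraNneq even_m => ->.
Qed.

Lemma xseqS (a n : nat) : 0 < n -> xseq a n.+1 = next_nu2 (xseq a n) n.+1.
Proof. by case: n. Qed.

Lemma xseq_block (a q k i : nat) : xseq a (2 ^ k) = q * 2 ^ k ->
  i < 2 ^ k -> xseq a (2 ^ k + i) = q * 2 ^ k + i.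
Proof.
move=> x_k; elim: i => [|i IHi] lt_i; first by rewrite !addn0.
rewrite !addnS xseqS ?addn_gt0 ?expn_gt0 // IHi; last exact: ltnW.
apply: next_nu2_succ; rewrite -!addnS nu2_add_small //.
by rewrite -[2 ^ k in RHS]mul1n nu2_add_small.
Qed.

Lemma xseq_pow2S (a q k : nat) : odd q -> xseq a (2 ^ k) = q * 2 ^ k ->
  xseq a (2 ^ k.+1) = (q.+1./2 + ~~ odd q.+1./2) * 2 ^ k.+1.
Proof.
move=> odd_q x_k; have pk_gt0 : 0 < 2 ^ k by rewrite expn_gt0.
have def_pk : 2 ^ k.+1 = (2 ^ k + (2 ^ k).-1).+1 by rewrite expnS; lia.
rewrite [in LHS]def_pk xseqS; last by rewrite addn_gt0 pk_gt0.
rewrite (@xseq_block a q) ?ltn_predL // -def_pk.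
(* As [q.+1] is even, the block ends just before a multiple of [2 ^ k.+1]. *)
have -> : q * 2 ^ k + (2 ^ k).-1 = (q.+1./2 * 2 ^ k.+1).-1.
  have def_q : q.+1 = q.+1./2 * 2 by rewrite muln2 even_halfK //= odd_q.
  by rewrite expnS mulnA -def_q mulSn; lia.
by apply: next_nu2_pred_mul; rewrite ?nu2_exp //; lia.
Qed.

Lemma xseq_reaches_3 (a q k : nat) : odd q -> 1 < q ->
  xseq a (2 ^ k) = q * 2 ^ k -> exists j, xseq a (2 ^ j) = 3 * 2 ^ j.
Proof.
elim/ltn_ind: q k => q IHq k odd_q q_gt1 x_k.
have [q3 | q_neq3] := eqVneq q 3; first by exists k; rewrite x_k q3.
apply: (IHq (q.+1./2 + ~~ odd q.+1./2) _ k.+1); last exact: xseq_pow2S.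
all: by lia.
Qed.

Lemma xseq3_pow2 (k : nat) : xseq 3 (2 ^ k) = 3 * 2 ^ k.
(* For [q = 3], [q.+1./2 = 2] is even and is bumped back to 3. *)
Proof. by elim: k => // k /xseq_pow2S->. Qed.

(** Past index 1, a term depends only on its index and the previous term. *)
Lemma eq_xseq_from (a b m n : nat) : 0 < m -> xseq a m = xseq b m ->
  m <= n -> xseq a n = xseq b n.
Proof.
move=> m_gt0 eq_m /subnKC <-; elim: (n - m) => [|i IHi]; first by rewrite addn0.
by rewrite addnS !xseqS ?addn_gt0 ?m_gt0 // IHi.
Qed.

Theorem theorem2 (a : nat) (odd_a : odd a) (a_gt1 : 1 < a) :
  exists n0 : nat, forall n : nat, n0 <= n -> xseq a n = xseq 3 n.
Proof.
have x_1 : xseq a (2 ^ 0) = a * 2 ^ 0 by rewrite muln1.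
have [j x_j] := xseq_reaches_3 _ _ _ odd_a a_gt1 x_1.
exists (2 ^ j) => n; apply: eq_xseq_from; first by rewrite expn_gt0.
by rewrite x_j xseq3_pow2.
Qed.
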